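(* (Chen's identity.) Let $\sigma,\Lambda,\Psi\in\mathcal G$. For every $\dagger\in\{\mathrm{hom},\mathrm{mono},\mathrm{regmono}\}$ and every $\ddagger\in\{\mathrm{hom}',\mathrm{mono}',\mathrm{regmono}'\}$, $$\langle\mathtt{GC}^{\dagger}(\Lambda\cdot_{\mathrm{hom}}\Psi),\sigma\rangle=\langle\mathtt{GC}^{\dagger}(\Lambda)\otimes\mathtt{GC}^{\dagger}(\Psi),\Delta_{\mathrm{hom}'}(\sigma)\rangle,$$ $$\langle\mathtt{GC}^{\ddagger}(\Lambda\cdot_{\mathrm{hom}}\Psi),\sigma\rangle=\langle\mathtt{GC}^{\ddagger}(\Lambda)\otimes\mathtt{GC}^{\ddagger}(\Psi),\Delta_{\mathrm{hom}}(\sigma)\rangle.$$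
   Context: Graphs are finite simple graphs (isolated vertices allowed, no loops, no parallel edges); $\mathsf e$ is the empty graph. $\mathrm{Hom}(\sigma,\tau)$ is the set of graph homomorphisms (maps $V(\sigma)\to V(\tau)$ sending edges to edges); $\mathrm{Mono}(\sigma,\tau)$ those injective on vertices; $\mathrm{RegMono}(\sigma,\tau)$ those that are isomorphisms onto the subgraph of $\tau$ induced by the image of $V(\sigma)$; $\mathrm{Aut}(\sigma)$ is the automorphism group. $\mathcal G$ is the set of isomorphism classes of graphs and $\langle\mathcal G\rangle_{\mathbb Q}$ the $\mathbb Q$-vector space with basis $\mathcal G$. $\cdot_{\mathrm{hom}}$ is the bilinear extension of disjoint union. $\Delta_{\mathrm{hom}}(\tau)$ is the sum of $\tau_1\otimes\tau_2$ over all ordered pairs $(\tau_1,\tau_2)\in\mathcal G\times\mathcal G$ with $\tau_1\cdot_{\mathrm{hom}}\tau_2=\tau$. $\Delta_{\mathrm{hom}'}$ is the unital algebra morphism for $\cdot_{\mathrm{hom}}$ with $\Delta_{\mathrm{hom}'}(\tau)=\tau\otimes\mathsf e+\mathsf e\otimes\tau$ for every (nonempty) connected $\tau$. For a graph $\Lambda$, the functionals $\mathtt{GC}^{x}(\Lambda)$ on $\langle\mathcal G\rangle_{\mathbb Q}$ are linear, with values at $\sigma\in\mathcal G$: $|\mathrm{Hom}(\sigma,\Lambda)|$ for $x=\mathrm{hom}$; $|\mathrm{Mono}(\sigma,\Lambda)|$ for $x=\mathrm{mono}$; $|\mathrm{RegMono}(\sigma,\Lambda)|$ for $x=\mathrm{regmono}$;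 and for $x=\mathrm{hom}',\mathrm{mono}',\mathrm{regmono}'$ the same numbers divided by $|\mathrm{Aut}(\sigma)|$. $\langle f,x\rangle$ is the value of $f$ at $x$, and $\langle f\otimes g,x\otimes y\rangle=\langle f,x\rangle\langle g,y\rangle$. *)

(* Defs.v *)
From HB Require Import structures.
From mathcomp Require Import all_boot all_order all_algebra.
From mathcomp Require Import finmap.
From mathcomp.multinomials Require Import monalg.

Set Implicit Arguments.
Unset Strict Implicit.
Unset Printing Implicit Defensive.

Import GRing.Theory.

Local Open Scope ring_scope.
Local Open Scope quotient_scope.

Record sgraph := SGraph {
  vert :> finType;
  adj : rel vert;
  adj_sym : symmetric adj;
  adj_irr : irreflexive adj }.
Arguments adj {s} : rename.

Section Morphisms.
Variables g h : sgraph.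

Definition Hom : {set {ffun g -> h}} :=
  [set f : {ffun g -> h} | [forall x, forall y, adj x y ==> adj (f x) (f y)]].

Definition Mono : {set {ffun g -> h}} := [set f in Hom | injectiveb f].

Definition RegMono : {set {ffun g -> h}} :=
  [set f : {ffun g -> h} | injectiveb f &
     [forall x, forall y, adj (f x) (f y) == adj x y]].

Definition Iso : {set {ffun g -> h}} :=
  [set f in RegMono | [forall y, y \in codom f]].

Definition iso : bool := Iso != set0.

End Morphisms.

Definition Aut (g : sgraph) : {set {ffun g -> g}} := Iso g g.

Lemma isoP (g h : sgraph) :
  reflect (exists2 f : g -> h,
             bijective f & forall x y, adj (f x) (f y) = adj x y)
          (iso g h).
Proof.
apply: (iffP (set0Pn _)) => [[f]|[f bf fE]].
  rewrite !inE => /andP[/andP[/injectiveP fi /forallP fE] /forallP fs].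
  exists f => [|x y]; last by have /forallP /(_ y) /eqP := fE x.
  exists (fun y => iinv (fs y)) => [x|y]; last exact: f_iinv.
  by apply: fi; rewrite f_iinv.
exists [ffun x => f x]; rewrite !inE -andbA; apply/and3P; split.
- by apply/injectiveP => x y; rewrite !ffunE; apply: bij_inj.
- by apply/forallP => x; apply/forallP => y; rewrite !ffunE fE.
apply/forallP => y; case: bf => f' fK f'K.
by apply/codomP; exists (f' y); rewrite ffunE f'K.
Qed.

Lemma iso_refl g : iso g g.
Proof. by apply/isoP; exists id => //; exists id. Qed.

Lemma iso_symi g h : iso g h -> iso h g.
Proof.
case/isoP=> f [f' fK f'K] fE; apply/isoP; exists f' => [|x y]; first by exists f.
by rewrite -fE !f'K.
Qed.

Lemma iso_sym g h : iso g h = iso h g.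
Proof. by apply/idP/idP; apply: iso_symi. Qed.

Lemma iso_trans h g k : iso g h -> iso h k -> iso g k.
Proof.
case/isoP=> f bf fE /isoP[f' bf' fE']; apply/isoP.
by exists (f' \o f) => [|x y /=]; [apply: bij_comp | rewrite fE' fE].
Qed.

(* Graphs on {0, ..., n-1}, as a choiceType containing a copy of every finite
   graph: isomorphism classes are formed by quotienting this type. *)
Definition is_adj n (e : {ffun 'I_n * 'I_n -> bool}) : bool :=
  [forall x, forall y, e (x, y) == e (y, x)] && [forall x, ~~ e (x, x)].

Definition ograph := {n : nat & {e : {ffun 'I_n * 'I_n -> bool} | is_adj e}}.

Section Decode.
Variable a : ograph.

Definition decode_adj : rel 'I_(tag a) := fun x y => val (tagged a) (x, y).

Lemma decode_adj_sym : symmetric decode_adj.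
Proof.
move=> x y; have /andP[/forallP /(_ x) /forallP /(_ y) /eqP H _] :=
  valP (tagged a); exact: H.
Qed.

Lemma decode_adj_irr : irreflexive decode_adj.
Proof.
by move=> x; have /andP[_ /forallP /(_ x) /negbTE] := valP (tagged a).
Qed.

Definition decode : sgraph := SGraph decode_adj_sym decode_adj_irr.

End Decode.

Section Encode.
Variable g : sgraph.

Definition encode_adj : {ffun 'I_#|g| * 'I_#|g| -> bool} :=
  [ffun p => adj (enum_val p.1) (enum_val p.2)].

Lemma encode_adjP : is_adj encode_adj.
Proof.
apply/andP; split; apply/forallP => x; last by rewrite ffunE /= adj_irr.
by apply/forallP => y; rewrite !ffunE /= adj_sym.
Qed.

Definition encode : ograph :=
  Tagged (fun n => {e : {ffun 'I_n * 'I_n -> bool} | is_adj e})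
    (exist (@is_adj _) encode_adj encode_adjP).

Lemma encodeK : iso (decode encode) g.
Proof.
apply/isoP; exists (enum_val : 'I_#|g| -> g); first exact: enum_val_bij.
by move=> x y; rewrite /= /decode_adj /= ffunE.
Qed.

End Encode.

Definition ograph_iso : rel ograph := fun a b => iso (decode a) (decode b).

Lemma ograph_iso_equiv : equiv_class_of ograph_iso.
Proof.
split=> [a|a b|b a c]; rewrite /ograph_iso; first exact: iso_refl.
  exact: iso_sym.
exact: iso_trans.
Qed.

Canonical ograph_iso_eqv := EquivRelPack ograph_iso_equiv.

Definition gclass := {eq_quot ograph_iso}.
HB.instance Definition _ := Choice.on gclass.
HB.instance Definition _ := EqQuotient.on gclass.

Definition cls (g : sgraph) : gclass := \pi_gclass (encode g).
Definition rep (x : gclass) : sgraph := decode (repr x).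

Lemma clsP g h : reflect (cls g = cls h) (iso g h).
Proof.
have E : iso g h = ograph_iso (encode g) (encode h).
  apply/idP/idP => H.
    apply: iso_trans (encodeK g) _; apply: iso_trans H _.
    by apply: iso_symi; apply: encodeK.
  apply: iso_trans (encodeK h); apply: iso_trans H.
  by apply: iso_symi; apply: encodeK.
by rewrite E; apply: (iffP idP) => [H|/eqmodP //]; apply/eqmodP.
Qed.

Lemma repK x : cls (rep x) = x.
Proof.
rewrite -[RHS]reprK; apply/eqmodP; exact: encodeK.
Qed.

Lemma cls_ind (P : gclass -> Prop) : (forall g, P (cls g)) -> forall x, P x.
Proof. by move=> H x; rewrite -(repK x). Qed.

Lemma rep_cls g : iso (rep (cls g)) g.
Proof. by apply/clsP; rewrite repK. Qed.

Section Operations.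

Definition void_adj : rel void := fun _ _ => false.
Lemma void_adj_sym : symmetric void_adj. Proof. by case. Qed.
Lemma void_adj_irr : irreflexive void_adj. Proof. by case. Qed.
Definition empty_graph := SGraph void_adj_sym void_adj_irr.

Variables g h : sgraph.

Definition dunion_adj : rel (g + h)%type := fun x y =>
  match x, y with
  | inl a, inl b => adj a b
  | inr a, inr b => adj a b
  | _, _ => false
  end.
Lemma dunion_adj_sym : symmetric dunion_adj.
Proof. by move=> [x|x] [y|y] //=; apply: adj_sym. Qed.
Lemma dunion_adj_irr : irreflexive dunion_adj.
Proof. by move=> [x|x] /=; apply: adj_irr. Qed.
Definition dunion := SGraph dunion_adj_sym dunion_adj_irr.

Variable S : {set g}.

Definition induced_adj : rel {x | x \in S} := fun x y => adj (val x) (val y).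
Lemma induced_adj_sym : symmetric induced_adj.
Proof. by move=> x y; apply: adj_sym. Qed.
Lemma induced_adj_irr : irreflexive induced_adj.
Proof. by move=> x; apply: adj_irr. Qed.
Definition induced := SGraph induced_adj_sym induced_adj_irr.

End Operations.

Definition connected_graph (g : sgraph) : bool :=
  (0 < #|g|)%N && [forall x : g, forall y : g, connect adj x y].

Lemma dunion_iso g g' h h' :
  iso g g' -> iso h h' -> iso (dunion g h) (dunion g' h').
Proof.
case/isoP=> f [f' fK f'K] fE /isoP[k [k' kK k'K] kE]; apply/isoP.
exists (fun x => match x with inl a => inl (f a) | inr b => inr (k b) end).
  exists (fun x => match x with inl a => inl (f' a) | inr b => inr (k' b) end);
  by case=> x; rewrite ?fK ?f'K ?kK ?k'K.
by case=> x [] y //=; rewrite ?fE ?kE.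
Qed.

Lemma connected_iso g h : iso g h -> connected_graph g = connected_graph h.
Proof.
suff H g' h' : iso g' h' -> connected_graph g' -> connected_graph h'.
  by move=> gh; apply/idP/idP; apply: H => //; apply: iso_symi.
case/isoP=> f [f' fK f'K] fE /andP[g0 /forallP gc]; apply/andP; split.
  by case/card_gt0P: g0 => x _; apply/card_gt0P; exists (f x).
apply/forallP => x; apply/forallP => y; rewrite -[x]f'K -[y]f'K.
have /forallP /(_ (f' y)) /connectP[p + ->] := gc (f' x).
elim: p (f' x) => [|z p IH] a //= /andP[az /IH]; apply: connect_trans.
by apply: connect1; rewrite fE.
Qed.

Definition closed_set (g : sgraph) (S : {set g}) : bool :=
  [forall x, forall y, adj x y ==> (x \in S) ==> (y \in S)].

Lemma closed_setP (g : sgraph) (S : {set g}) :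
  reflect (forall x y, adj x y -> (x \in S) = (y \in S)) (closed_set S).
Proof.
apply: (iffP forallP) => [H x y xy|H x].
  have /forallP /(_ y) /implyP /(_ xy) /implyP xyS := H x.
  rewrite adj_sym in xy.
  have /forallP /(_ x) /implyP /(_ xy) /implyP yxS := H y.
  by apply/idP/idP.
by apply/forallP => y; apply/implyP => xy; rewrite (H _ _ xy) implybb.
Qed.

(* Disjoint union makes the isomorphism classes a commutative monoid; the product
   of {malg rat[gclass]} is then its bilinear extension. *)
Definition gclass1 : gclass := cls empty_graph.
Definition gclassM (x y : gclass) : gclass := cls (dunion (rep x) (rep y)).

Lemma clsM g h : gclassM (cls g) (cls h) = cls (dunion g h).
Proof. by apply/clsP; apply: dunion_iso; apply: rep_cls. Qed.

Lemma gclassMC : commutative gclassM.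
Proof.
elim/cls_ind=> g; elim/cls_ind=> h; rewrite !clsM; apply/clsP; apply/isoP.
pose s g h (x : dunion g h) : dunion h g :=
  match x with inl a => inr a | inr b => inl b end.
by exists (@s g h); [exists (@s h g); case | case=> x []].
Qed.

Lemma gclassMA : associative gclassM.
Proof.
elim/cls_ind=> g; elim/cls_ind=> h; elim/cls_ind=> k; rewrite !clsM.
apply/clsP; apply/isoP.
exists (fun x : dunion g (dunion h k) => match x with
  | inl a => inl (inl a) | inr (inl a) => inl (inr a) | inr (inr a) => inr a
  end : dunion (dunion g h) k).
  exists (fun x : dunion (dunion g h) k => match x with
    | inl (inl a) => inl a | inl (inr a) => inr (inl a) | inr a => inr (inr a)
    end : dunion g (dunion h k)).
    by case=> [|[]].
  by case=> [[]|].
by case=> [x|[]x] [y|[]y].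
Qed.

Lemma gclass1M : left_id gclass1 gclassM.
Proof.
elim/cls_ind=> g; rewrite clsM; apply/clsP; apply/isoP.
exists (fun x : dunion empty_graph g => match x with
  inl a => match a : void with end | inr b => b end).
  by exists (@inr void g : g -> dunion empty_graph g) => [[[]|]|].
by case=> [[]|x] [[]|y].
Qed.

Lemma gclassM1 : right_id gclass1 gclassM.
Proof. by move=> x; rewrite gclassMC gclass1M. Qed.

Lemma iso_card (g h : sgraph) : iso g h -> #|g| = #|h|.
Proof. by case/isoP=> f bf _; apply: bij_eq_card bf. Qed.

Lemma cls_eq1 (g : sgraph) : #|g| = 0%N -> cls g = gclass1.
Proof.
move=> g0; have gF (x : g) : False by have := fintype0 x g0.
apply/clsP/isoP; exists (fun x => match gF x with end) => [|x]; last by case: gF.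
by exists (fun x : void => match x with end) => x; case: (gF x) || case: x.
Qed.

Lemma gclass_unit x y :
  gclassM x y = gclass1 -> x = gclass1 /\ y = gclass1.
Proof.
elim/cls_ind: x => g; elim/cls_ind: y => h; rewrite clsM => /clsP /iso_card.
rewrite /= card_sum card_void => /eqP; rewrite addn_eq0 => /andP[/eqP ? /eqP ?].
by split; apply: cls_eq1.
Qed.

HB.instance Definition _ := Choice_isMonomialDef.Build gclass
  gclassMA gclass1M gclassM1 gclass_unit.
HB.instance Definition _ := MonomialDef_isConomialDef.Build gclass gclassMC.

Section ProdMonomial.
Variables K L : conomType.
Implicit Types x y z : K * L.

Definition pone : K * L := (mone, mone).
Definition pmul x y : K * L := (mmul x.1 y.1, mmul x.2 y.2).

Lemma pmulA : associative pmul.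
Proof. by move=> x y z; rewrite /pmul !mulmA. Qed.
Lemma pmul1m : left_id pone pmul.
Proof. by case=> x y; rewrite /pmul !mul1m. Qed.
Lemma pmulm1 : right_id pone pmul.
Proof. by case=> x y; rewrite /pmul !mulm1. Qed.
Lemma punitm x y : pmul x y = pone -> x = pone /\ y = pone.
Proof. by case: x y => [a b] [c d] [] /unitm[-> ->] /unitm[-> ->]. Qed.
Lemma pmulC : commutative pmul.
Proof. by move=> x y; rewrite /pmul mulmC [mmul x.2 _]mulmC. Qed.

HB.instance Definition _ := Choice_isMonomialDef.Build (K * L)%type
  pmulA pmul1m pmulm1 punitm.
HB.instance Definition _ := MonomialDef_isConomialDef.Build (K * L)%type pmulC.

End ProdMonomial.

HB.lock Definition linext (K : choiceType) (W : lmodType rat) (h : K -> W)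
  (x : {malg rat[K]}) : W := \sum_(k <- msupp x) x@_k *: h k.

Section LinearExtension.
Variables (K : choiceType) (W : lmodType rat) (h : K -> W).
Local Notation linext := (linext h).

Lemma linextE x : linext x = \sum_(k <- msupp x) x@_k *: h k.
Proof. by rewrite linext.unlock. Qed.

Lemma linextEw (d : {fset K}) x : (msupp x `<=` d)%fset ->
  linext x = \sum_(k <- d) x@_k *: h k.
Proof.
move=> le; rewrite linext.unlock [LHS](big_fset_incl _ le) => //= k kd /mcoeff_outdom ->.
by rewrite scale0r.
Qed.

Lemma linext_is_linear : linear linext.
Proof.
move=> c x y; have le1 := fsubsetUl (msupp x) (msupp y).
have le2 := fsubsetUr (msupp x) (msupp y).
have le3 : (msupp (c *: x + y) `<=` msupp x `|` msupp y)%fset.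
  apply: fsubset_trans (msuppD_le _ _) _; apply: fsetSU; exact: msuppZ_le.
rewrite (linextEw le1) (linextEw le2) (linextEw le3) scaler_sumr -big_split /=.
by apply: eq_bigr => k _; rewrite mcoeffD mcoeffZ scalerDl scalerA.
Qed.

HB.instance Definition _ :=
  GRing.isLinear.Build rat {malg rat[K]} W _ linext linext_is_linear.

Lemma linextU k : linext << k >> = h k.
Proof.
by rewrite (linextEw msuppU_le) big_seq_fset1 mcoeffUU scale1r.
Qed.

End LinearExtension.

Notation QG := {malg rat[gclass]}.

(* The tensor square of a free module, as the free module on pairs; its product
   is the one of the tensor product of algebras (tensUM). *)
Notation QGG := {malg rat[(gclass * gclass)%type]}.

HB.lock Definition tens (x y : QG) : QGG :=
  \sum_(k <- msupp x) \sum_(l <- msupp y) (x@_k * y@_l) *: << (k, l) >>.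

Notation "x \ox y" := (tens x y) (at level 40, left associativity) : ring_scope.

Lemma tensE (x y : QG) :
  x \ox y = linext (fun k => linext (fun l => << (k, l) >>) y) x.
Proof.
rewrite tens.unlock linext.unlock; apply: eq_bigr => k _; rewrite scaler_sumr; apply: eq_bigr => l _.
by rewrite scalerA.
Qed.

Lemma tensU (k l : gclass) : << k >> \ox << l >> = << (k, l) >>.
Proof. by rewrite tensE !linextU. Qed.

Lemma malg_basisE (K : choiceType) (z : {malg rat[K]}) :
  z = \sum_(k <- msupp z) z@_k *: << k >>.
Proof.
rewrite {1}[z]monalgE; apply: eq_bigr => k _; apply/malgP => l.
by rewrite mcoeffZ !mcoeffU; case: (k == l); rewrite ?mulr1 ?mulr0.
Qed.

Lemma malg_ind (K : choiceType) (P : {malg rat[K]} -> Prop) :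
  P 0 -> (forall u v, P u -> P v -> P (u + v)) ->
  (forall c u, P u -> P (c *: u)) -> (forall k, P << k >>) -> forall u, P u.
Proof.
move=> P0 PD PZ PU u; rewrite [u]malg_basisE; apply: (big_ind P) => // k _.
exact: PZ.
Qed.

Lemma malgMU (K : monomType) (k l : K) :
  << k >> * << l >> = << mmul k l >> :> {malg rat[K]}.
Proof. by rewrite malgM_def fgmulUU mulr1. Qed.

Lemma tensUM (k l m n : gclass) :
  (<< k >> \ox << l >>) * (<< m >> \ox << n >>) =
  << mmul k m >> \ox << mmul l n >>.
Proof. by rewrite [LHS](f_equal2 *%R (tensU k l) (tensU m n)) malgMU tensU. Qed.

Definition tensf (f g : {scalar QG}) : QGG -> rat :=
  linext (fun p => f << p.1 >> * g << p.2 >> : rat^o).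

HB.instance Definition _ f g := GRing.isLinear.Build rat QGG rat _ (tensf f g)
  (linext_is_linear (fun p => f << p.1 >> * g << p.2 >> : rat^o)).

Lemma tensfE (f g : {scalar QG}) (x y : QG) :
  tensf f g (x \ox y) = f x * g y.
Proof.
have fE (u : {scalar QG}) (z : QG) :
    u z = \sum_(k <- msupp z) z@_k * u << k >>.
  rewrite {1}[z]malg_basisE linear_sum; apply: eq_bigr => k _; exact: linearZ.
rewrite tens.unlock linear_sum (fE f x) (fE g y) mulr_suml; apply: eq_bigr => k _.
rewrite linear_sum mulr_sumr; apply: eq_bigr => l _ /=.
by rewrite linearZ /= /tensf linextU /= mulrACA.
Qed.

Lemma embed_iso (k g : sgraph) (S : {set g}) (f : k -> g) :
  injective f -> (forall x y, adj (f x) (f y) = adj x y) ->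
  (forall y, (y \in S) = (y \in codom f)) -> iso k (induced S).
Proof.
move=> fi fE fS; have fin x : f x \in S by rewrite fS codom_f.
apply/isoP; exists (fun x => exist _ (f x) (fin x) : induced S) => [|x y];
  last exact: fE.
have Sf (y : induced S) : val y \in codom f by rewrite -fS (valP y).
exists (fun y => iinv (Sf y)) => [x|y].
  by apply: fi; rewrite f_iinv.
by apply: val_inj; rewrite /= f_iinv.
Qed.

Lemma induced_setT (g : sgraph) : iso (induced [set: g]) g.
Proof.
apply: iso_symi; apply: (@embed_iso _ _ _ id) => // y.
by rewrite inE; apply/esym/codomP; exists y.
Qed.

Lemma closed_set_split (g : sgraph) (S : {set g}) :
  closed_set S -> iso (dunion (induced S) (induced (~: S))) g.
Proof.
move/closed_setP => Sc; apply: iso_trans (induced_setT g).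
pose f (x : dunion (induced S) (induced (~: S))) : g :=
  match x with inl a => val a | inr b => val b end.
apply: (@embed_iso _ _ _ f).
- move=> [[x xS]|[x xS]] [[y yS]|[y yS]] //= E; subst.
  + by congr inl; apply: val_inj.
  + by have := yS; rewrite inE xS.
  + by have := xS; rewrite inE yS.
  + by congr inr; apply: val_inj.
- move=> [[x xS]|[x xS]] [[y yS]|[y yS]] //=; apply/negP => /Sc.
    by have := yS; rewrite inE xS => /negbTE ->.
  by have := xS; rewrite inE yS => /negbTE ->.
move=> y; rewrite inE; apply/esym/codomP.
case: (boolP (y \in S)) => yS; first by exists (inl (exist _ y yS)).
have yS' : y \in ~: S by rewrite inE.
by exists (inr (exist _ y yS')).
Qed.

(* The pairs (x, y) with x * y = z: both are classes of induced subgraphs of a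
   representative of z, which bounds the search. *)
Definition subclasses (z : gclass) : {fset gclass} :=
  [fset cls (induced S) | S in {: {set rep z}}]%fset.

Definition splittings (z : gclass) : {fset gclass * gclass} :=
  [fset p in (subclasses z `*` subclasses z) | mmul p.1 p.2 == z]%fset.

Lemma in_splittings z p : (p \in splittings z) = (mmul p.1 p.2 == z).
Proof.
rewrite !inE; case: eqP => [E|_]; last by rewrite andbF.
have sub x y : mmul x y = z -> x \in subclasses z.
  elim/cls_ind: x => g; elim/cls_ind: y => h.
  rewrite -{1}(repK z) [mmul _ _]clsM => /clsP /isoP[f bf fE].
  apply/imfsetP; exists [set f (inl a) | a : g] => //.
  apply/clsP; apply: (@embed_iso _ _ _ (fun a => f (inl a))).
  - by move=> a b /(bij_inj bf) [].
  - by move=> a b; rewrite fE.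
  by move=> y; apply/imsetP/codomP => [[a _ ->]|[a ->]]; exists a.
by rewrite (sub _ p.2 E) (sub p.2 p.1) // mulmC.
Qed.

Definition Delta_hom : QG -> QGG :=
  linext (fun z => \sum_(p <- splittings z) << p.1 >> \ox << p.2 >>).

HB.instance Definition _ := GRing.Linear.on Delta_hom.

Definition connected (x : gclass) : bool := connected_graph (rep x).

Lemma connected_cls g : connected (cls g) = connected_graph g.
Proof. by apply: connected_iso; apply: rep_cls. Qed.

Definition closed_split (g : sgraph) : QGG :=
  \sum_(S : {set g} | closed_set S)
     << (cls (induced S), cls (induced (~: S))) >>.

Lemma closed_split_iso g h : iso g h -> closed_split g = closed_split h.
Proof.
case/isoP => f bf fE.
have fi := bij_inj bf.
have [f' fK f'K] := bf.
have imf (S : {set g}) y : (f y \in f @: S) = (y \in S) by rewrite mem_imset.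
have ic (S : {set g}) : ~: (f @: S) = f @: (~: S).
  by apply/setP => y; rewrite -[y]f'K inE !imf inE.
have ii (S : {set g}) : cls (induced (f @: S)) = cls (induced S).
  apply/clsP/iso_symi.
  apply: (@embed_iso _ _ _ (fun x : induced S => f (val x))) => [x y|x y|y].
  - by move/fi/val_inj.
  - exact: fE.
  apply/imsetP/codomP => [[x xS ->]|[x ->]]; last by exists (val x); first exact: (valP x).
  by exists (exist _ x xS).
rewrite /closed_split (reindex (fun S : {set g} => f @: S)) /=.
  apply: eq_big => [S|S _]; last by rewrite ic !ii.
  apply/closed_setP/closed_setP => H x y xy; last first.
    by rewrite -!imf; apply: H; rewrite fE.
  by rewrite -[x]f'K -[y]f'K !imf; apply: H; rewrite -fE !f'K.
exists (fun S : {set h} => f' @: S) => S _; apply/setP => y.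
  by rewrite -{1}[y]fK mem_imset ?imf //; apply: can_inj f'K.
by rewrite -{1}[y]f'K imf mem_imset //; apply: can_inj f'K.
Qed.

Lemma closed_split_dunion g h :
  closed_split (dunion g h) = closed_split g * closed_split h.
Proof.
pose U (p : {set g} * {set h}) : {set dunion g h} :=
  [set x : (g + h)%type | match x with inl a => a \in p.1 | inr b => b \in p.2 end].
have UE p : cls (induced (U p)) = mmul (cls (induced p.1)) (cls (induced p.2)).
  rewrite [RHS]clsM; apply/clsP/iso_symi.
  apply: (@embed_iso _ _ _ (fun x : dunion (induced p.1) (induced p.2) =>
    match x with inl a => inl (val a) | inr b => inr (val b) end : dunion g h)).
  - by move=> [x|x] [y|y] //= [] /val_inj ->.
  - by move=> [x|x] [y|y].
  move=> y; apply/idP/codomP => [|[[x|x] ->]]; last 2 first.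
  - by rewrite inE; apply: valP x.
  - by rewrite inE; apply: valP x.
  rewrite inE; case: y => y yp; first by exists (inl (exist _ y yp)).
  by exists (inr (exist _ y yp)).
have UC p : ~: U p = U (~: p.1, ~: p.2).
  by apply/setP => -[x|x]; rewrite !inE.
rewrite /closed_split big_distrlr pair_big /= (reindex U) /=.
  apply: eq_big => [p|p _]; last by rewrite UC !UE malgMU.
  apply/closed_setP/andP => [H|[/closed_setP H1 /closed_setP H2]].
    split; apply/closed_setP => x y xy.
      by have := H (inl x) (inl y) xy; rewrite !inE.
    by have := H (inr x) (inr y) xy; rewrite !inE.
  by move=> [x|x] [y|y] // xy; rewrite !inE; [apply: H1 | apply: H2].
exists (fun V : {set dunion g h} => ([set a | inl a \in V], [set b | inr b \in V])).
  by move=> [S T] _; congr pair; apply/setP => x; rewrite !inE.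
by move=> V _; apply/setP => -[x|x]; rewrite !inE.
Qed.

Lemma cls_induced0 (g : sgraph) : cls (induced (set0 : {set g})) = mone.
Proof. by apply: cls_eq1; apply: eq_card0 => -[x xP]; have := xP; rewrite inE. Qed.

Lemma cls_inducedT (g : sgraph) : cls (induced [set: g]) = cls g.
Proof. by apply/clsP; apply: induced_setT. Qed.

Lemma closed_split_connected g : connected_graph g ->
  closed_split g = << (cls g, mone) >> + << (mone, cls g) >>.
Proof.
case/andP => /card_gt0P[x0 _] /forallP gc.
have T0 : [set: g] != set0 by apply/set0Pn; exists x0; rewrite inE.
have c0 : closed_set (set0 : {set g}) by apply/closed_setP => x y; rewrite !inE.
have cT : closed_set [set: g] by apply/closed_setP => x y; rewrite !inE.
rewrite /closed_split (bigD1 setT) //= (bigD1 set0) /=; last first.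
  by rewrite c0 eq_sym.
rewrite big1 => [|S /andP[/andP[/closed_setP Sc ST] S0]].
  rewrite setC0 setCT (cls_inducedT g) (cls_induced0 g).
  by apply: (f_equal (+%R _)); apply: addr0.
case/negP: ST; apply/eqP/setP => y; rewrite [RHS]inE.
case/set0Pn: S0 => x; have /forallP /(_ y) /connectP[p + ->] := gc x.
elim: p x => [|z p IH] x //= /andP[/Sc -> /IH]; exact.
Qed.

Definition closed_split_ext : QG -> QGG :=
  linext (fun x => closed_split (rep x)).

HB.instance Definition _ := GRing.Linear.on closed_split_ext.

Lemma closed_split_ext_cls g : closed_split_ext << cls g >> = closed_split g.
Proof.
by rewrite /closed_split_ext linextU; apply: closed_split_iso; apply: rep_cls.
Qed.

(* Multiplicativity of a linear map may be checked one linear argument at a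
   time. *)
Section LinearMul.
Variables (A B : comAlgType rat) (f : {linear A -> B}).
Implicit Types u v w : A.

Let P u w := f (u * w) = f u * f w.

Lemma linmul_sym u w : P u w -> P w u.
Proof. by rewrite /P mulrC => ->; rewrite mulrC. Qed.

Lemma linmul0 w : P 0 w.
Proof. by rewrite /P mul0r !linear0 mul0r. Qed.

Lemma linmulD w u v : P u w -> P v w -> P (u + v) w.
Proof. by rewrite /P mulrDl !linearD mulrDl => -> ->. Qed.

Lemma linmulZ w c u : P u w -> P (c *: u) w.
Proof. by rewrite /P -scalerAl !linearZ /= -scalerAl => ->. Qed.

End LinearMul.

Lemma closed_split_ext_monoid : monoid_morphism closed_split_ext.
Proof.
split=> [|x y].
  rewrite [LHS]closed_split_ext_cls /closed_split (bigD1 set0) /=; last first.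
    by apply/closed_setP => -[].
  rewrite big1 ?addr0 => [|S /andP[_ /set0Pn[[]]]].
  rewrite cls_induced0; suff -> : ~: (set0 : {set empty_graph}) = set0.
    by rewrite cls_induced0.
  by apply/setP => -[].
elim/malg_ind: x => [|u v|c u|k].
- exact: (linmul0 closed_split_ext).
- exact: (@linmulD _ _ closed_split_ext).
- exact: (@linmulZ _ _ closed_split_ext).
apply: (@linmul_sym _ _ closed_split_ext).
elim/malg_ind: y => [|u v|c u|l].
- exact: (linmul0 closed_split_ext).
- exact: (@linmulD _ _ closed_split_ext).
- exact: (@linmulZ _ _ closed_split_ext).
elim/cls_ind: k => g; elim/cls_ind: l => h.
have e : << cls h >> * << cls g >> = << cls (dunion h g) >> :> QG.
  by rewrite -clsM; apply: malgMU.
apply: etrans (f_equal closed_split_ext e) _.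
apply: etrans (closed_split_ext_cls _) _; rewrite closed_split_dunion.
by apply: (f_equal2 *%R); apply: esym; apply: closed_split_ext_cls.
Qed.

HB.instance Definition _ := GRing.isMonoidMorphism.Build QG QGG
  closed_split_ext closed_split_ext_monoid.

Definition is_Delta_hom' (D : QG -> QGG) : Prop := forall x : gclass,
  connected x -> D << x >> = << x >> \ox 1 + 1 \ox << x >>.

Lemma Delta_hom'_exists : {D : {lrmorphism QG -> QGG} | is_Delta_hom' D}.
Proof.
exists closed_split_ext; elim/cls_ind=> g; rewrite connected_cls => gc.
apply: etrans (closed_split_ext_cls g) _.
apply: etrans (closed_split_connected gc) _.
by apply: (f_equal2 +%R); apply: esym; apply: tensU.
Qed.

Lemma Delta_hom'_unique (D E : {lrmorphism QG -> QGG}) :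
  is_Delta_hom' D -> is_Delta_hom' E -> D =1 E.
Proof.
move=> HD HE; elim/malg_ind => [|u v Hu Hv|c u Hu|].
- by rewrite !linear0.
- by rewrite !linearD /= Hu Hv.
- by rewrite !linearZ /= Hu.
elim/cls_ind=> g; have [n] := ubnP #|g|; elim: n => // n IH in g *; rewrite ltnS => gn.
case: (boolP (connected_graph g)) => [gc|].
  by rewrite HD ?HE // connected_cls.
rewrite negb_and lt0n negbK => /orP[/eqP /cls_eq1 ->|].
  by rewrite -[<< _ >>]/(1 : QG) !rmorph1.
case/forallPn => x /forallPn[y xy].
pose S := [set z : g | connect adj x z].
have Sc : closed_set S.
  apply/closed_setP => u v uv; rewrite !inE; apply/idP/idP => H.
    by apply: connect_trans H _; apply: connect1.
  by apply: connect_trans H _; apply: connect1; rewrite adj_sym.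
have cE (T : {set g}) : #|induced T| = #|T| by rewrite card_sig; apply: eq_card.
have S0 : (0 < #|S|)%N by apply/card_gt0P; exists x; rewrite inE connect0.
have S1 : (0 < #|~: S|)%N by apply/card_gt0P; exists y; rewrite !inE.
have SS := cardsC S.
have eg : << cls g >> =
    << cls (induced S) >> * << cls (induced (~: S)) >> :> QG.
  apply: etrans (esym (malgMU _ _)); congr << _ >>.
  by apply: etrans (esym (clsM _ _)); apply/esym/clsP/closed_set_split.
have IS : D << cls (induced S) >> = E << cls (induced S) >>.
  apply: IH; rewrite cE; apply: leq_trans gn; rewrite -SS.
  by rewrite -[ltnLHS]addn0 ltn_add2l.
have IC : D << cls (induced (~: S)) >> = E << cls (induced (~: S)) >>.
  apply: IH; rewrite cE; apply: leq_trans gn; rewrite -SS.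
  by rewrite -[ltnLHS]add0n ltn_add2r.
apply: etrans (f_equal D eg) _; apply: etrans (rmorphM D _ _) _.
apply: etrans (f_equal2 *%R IS IC) _; apply: etrans (esym (rmorphM E _ _)) _.
exact: (f_equal E (esym eg)).
Qed.

Definition Delta_hom' : {lrmorphism QG -> QGG} := sval Delta_hom'_exists.

Lemma Delta_hom'E : is_Delta_hom' Delta_hom'.
Proof. exact: svalP Delta_hom'_exists. Qed.

Variant kind := hom | mono | regmono.

Definition maps (k : kind) (g h : sgraph) : {set {ffun g -> h}} :=
  match k with
  | hom => Hom g h
  | mono => Mono g h
  | regmono => RegMono g h
  end.

Lemma conj_mapsP (g h g' h' : sgraph) : iso g g' -> iso h h' ->
  exists F : {ffun g -> h} -> {ffun g' -> h'},
    [/\ injective F, forall k f, f \in maps k g h -> F f \in maps k g' h'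
      & forall f, f \in Iso g h -> F f \in Iso g' h'].
Proof.
case/isoP=> a [a' aK a'K] aE /isoP[b [b' bK b'K] bE].
have a'E x y : adj (a' x) (a' y) = adj x y by rewrite -aE !a'K.
pose F (f : {ffun g -> h}) : {ffun g' -> h'} := [ffun x => b (f (a' x))].
have FH f : f \in Hom g h -> F f \in Hom g' h'.
  rewrite !inE => /forallP H; apply/forallP => x; apply/forallP => y.
  by have /forallP /(_ (a' y)) := H (a' x); rewrite !ffunE bE a'E.
have FI (f : {ffun g -> h}) : injectiveb f -> injectiveb (F f).
  move=> /injectiveP fi; apply/injectiveP => x y; rewrite !ffunE.
  by move=> /(can_inj bK) /fi /(can_inj a'K).
have FR f : f \in RegMono g h -> F f \in RegMono g' h'.
  rewrite !inE => /andP[/FI -> /forallP H]; apply/forallP => x.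
  apply/forallP => y.
  by have /forallP /(_ (a' y)) := H (a' x); rewrite !ffunE bE a'E.
exists F; split.
- move=> f1 f2 /ffunP E; apply/ffunP => x; apply: (can_inj bK).
  by have := E (a x); rewrite !ffunE aK.
- case=> f; [exact: FH | | exact: FR].
  by rewrite inE => /andP[/FH fH /FI fI]; rewrite inE fH.
move=> f; rewrite inE => /andP[/FR fR /forallP fs]; rewrite inE fR.
apply/forallP => y; have /codomP[x xE] := fs (b' y).
by apply/codomP; exists (a x); rewrite ffunE aK -xE b'K.
Qed.

(* The numbers used below depend only on isomorphism classes. *)
Lemma card_maps_iso k (g h g' h' : sgraph) : iso g g' -> iso h h' ->
  #|maps k g h| = #|maps k g' h'|.
Proof.
suff le (u v u' v' : sgraph) : iso u u' -> iso v v' ->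
    (#|maps k u v| <= #|maps k u' v'|)%N.
  by move=> i j; apply/eqP; rewrite eqn_leq !le // iso_symi.
move=> i j; have [F [Fi Fm _]] := conj_mapsP i j.
rewrite -(card_imset _ Fi); apply/subset_leq_card/subsetP.
by move=> _ /imsetP[f /Fm + ->].
Qed.

Lemma card_Aut_iso (g g' : sgraph) : iso g g' -> #|Aut g| = #|Aut g'|.
Proof.
suff le (u u' : sgraph) : iso u u' -> (#|Aut u| <= #|Aut u'|)%N.
  by move=> i; apply/eqP; rewrite eqn_leq !le // iso_symi.
move=> i; have [F [Fi _ Fm]] := conj_mapsP i i.
rewrite -(card_imset _ Fi); apply/subset_leq_card/subsetP.
by move=> _ /imsetP[f /Fm + ->].
Qed.

Definition GC (k : kind) (L : gclass) : QG -> rat :=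
  linext (fun x => #|maps k (rep x) (rep L)|%:R : rat^o).

(* GC' k is GC for the primed version of k. *)
Definition GC' (k : kind) (L : gclass) : QG -> rat :=
  linext (fun x => #|maps k (rep x) (rep L)|%:R / #|Aut (rep x)|%:R : rat^o).

HB.instance Definition _ k L := GRing.isLinear.Build rat QG rat _ (GC k L)
  (linext_is_linear (fun x => #|maps k (rep x) (rep L)|%:R : rat^o)).

HB.instance Definition _ k L := GRing.isLinear.Build rat QG rat _ (GC' k L)
  (linext_is_linear
    (fun x => #|maps k (rep x) (rep L)|%:R / #|Aut (rep x)|%:R : rat^o)).

Lemma GC_cls k g L : GC k (cls L) << cls g >> = #|maps k g L|%:R.
Proof.
rewrite /GC linextU; congr (_%:R).
by apply: card_maps_iso; apply: rep_cls.
Qed.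

Lemma GC'_cls k g L :
  GC' k (cls L) << cls g >> = #|maps k g L|%:R / #|Aut g|%:R.
Proof.
rewrite /GC' linextU; congr (_%:R / _%:R).
  by apply: card_maps_iso; apply: rep_cls.
by apply: card_Aut_iso; apply: rep_cls.
Qed.

(* Main.v *)
(* A morphism f from g to a disjoint union a + b is the same as the closed set
   S = f^-1(a) (a union of components of g) together with a morphism S -> a and a
   morphism ~: S -> b; f is injective (regular, bijective) iff both parts are.
   Since Delta_hom' sums over the closed sets, this is the first identity.
   Applied to isomorphisms g -> a + b, the same bijection shows that exactly
   |Aut(a + b)| / (|Aut a| |Aut b|) closed sets of a + b have type (a, b), and
   grouping the closed sets by type gives the second identity. *)
Require Import Defs.
From HB Require Import structures.
From mathcomp Require Import all_boot all_order all_algebra.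
From mathcomp Require Import finmap.
From mathcomp.multinomials Require Import monalg.

Set Implicit Arguments.
Unset Strict Implicit.
Unset Printing Implicit Defensive.

Import GRing.Theory.
Local Open Scope ring_scope.

(** * Gluing morphisms into a disjoint union *)

Section Glue.
Variables (g a b : sgraph).
Implicit Types (S : {set g}) (f : {ffun g -> dunion a b}).

Definition left_part f : {set g} := [set x | if f x is inl _ then true else false].

(** No edge of [dunion a b] joins the two summands, so the ends of an edge of [g] land in the same
    one. *)
Lemma left_part_closed f : f \in Defs.Hom g (dunion a b) -> closed_set (left_part f).
Proof.
rewrite inE => /forallP fH; apply/closed_setP => x y xy; rewrite !inE.
by have /forallP /(_ y) /implyP /(_ xy) := fH x; case: (f x); case: (f y).
Qed.

(** Deciding membership through [decP] gives each branch the proof needed to build a vertex of the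
    induced subgraph. *)
Definition side S (x : g) : (induced S + induced (~: S))%type :=
  match decP (@idP (x \in S)) with
  | left xS => inl (exist _ x xS)
  | right xS => inr (exist _ x (etrans (in_setC x S) (introT negP xS)))
  end.

Lemma side_inl S (y : induced S) : side S (val y) = inl y.
Proof.
rewrite /side; case: decP => [yS|[]]; last exact: valP y.
by congr inl; apply: val_inj.
Qed.

Lemma side_inr S (y : induced (~: S)) : side S (val y) = inr y.
Proof.
rewrite /side; case: decP => [yS|yS]; last by congr inr; apply: val_inj.
by have := valP y; rewrite inE yS.
Qed.

(** Case analysis with it replaces a vertex by some [val y], the form in which [glue_inl] and
    [glue_inr] rewrite. *)
Variant side_spec S : g -> Type :=
  | SideIn (y : induced S) : side_spec S (val y)
  | SideOut (y : induced (~: S)) : side_spec S (val y).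

Lemma sideP S x : side_spec S x.
Proof.
case: (boolP (x \in S)) => xS; first exact: (@SideIn S (exist _ x xS)).
exact: (@SideOut S (exist _ x (etrans (in_setC x S) xS))).
Qed.

Variables (S : {set g}) (u : {ffun induced S -> a})
  (v : {ffun induced (~: S) -> b}).

Definition glue : {ffun g -> dunion a b} :=
  [ffun x => match side S x with inl y => inl (u y) | inr y => inr (v y) end].

Lemma glue_inl (y : induced S) : glue (val y) = inl (u y).
Proof. by rewrite ffunE side_inl. Qed.

Lemma glue_inr (y : induced (~: S)) : glue (val y) = inr (v y).
Proof. by rewrite ffunE side_inr. Qed.

Lemma left_part_glue : left_part glue = S.
Proof.
apply/setP => x; rewrite inE; case: (sideP S x) => y.
  by rewrite glue_inl (valP y).
by rewrite glue_inr; have := valP y; rewrite inE => /negbTE ->.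
Qed.

Lemma glue_injective : injectiveb glue = injectiveb u && injectiveb v.
Proof.
apply/injectiveP/andP => [gi|[/injectiveP ui /injectiveP vi] x x'].
  split; apply/injectiveP => y y' E; apply/val_inj/gi.
    by rewrite !glue_inl E.
  by rewrite !glue_inr E.
by case: (sideP S x) => y; case: (sideP S x') => y';
  rewrite ?glue_inl ?glue_inr // => -[]; [move/ui-> | move/vi->].
Qed.

Lemma glue_surjective : [forall z, z \in codom glue] =
  [forall z, z \in codom u] && [forall z, z \in codom v].
Proof.
apply/forallP/andP => [gs|[/forallP us /forallP vs] [z|z]].
- split; apply/forallP => z.
    have /codomP[x] := gs (inl z); case: (sideP S x) => y.
      by rewrite glue_inl => -[->]; apply: codom_f.
    by rewrite glue_inr.
  have /codomP[x] := gs (inr z); case: (sideP S x) => y.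
    by rewrite glue_inl.
  by rewrite glue_inr => -[->]; apply: codom_f.
- by have /codomP[y ->] := us z; rewrite -glue_inl codom_f.
- by have /codomP[y ->] := vs z; rewrite -glue_inr codom_f.
Qed.

Hypothesis clS : closed_set S.

Lemma adj_across (y : induced S) (z : induced (~: S)) :
  adj (val y) (val z) = false.
Proof.
apply/negP => /(closed_setP _ clS); rewrite (valP y).
by have := valP z; rewrite inE => /negbTE ->.
Qed.

(** Two vertices on the same side reduce to [u] or [v]; a mixed pair is never adjacent, as [S] is
    closed. *)
Lemma glue_hom : (glue \in Defs.Hom g (dunion a b)) =
  (u \in Defs.Hom (induced S) a) && (v \in Defs.Hom (induced (~: S)) b).
Proof.
rewrite !inE; apply/forallP/andP => [gH|[/forallP uH /forallP vH] x].
  split; apply/forallP => y; apply/forallP => y'.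
    by have /forallP /(_ (val y')) := gH (val y); rewrite !glue_inl.
  by have /forallP /(_ (val y')) := gH (val y); rewrite !glue_inr.
apply/forallP => x'.
case: (sideP S x) => y; case: (sideP S x') => y'.
- by rewrite !glue_inl; have /forallP := uH y; apply.
- by rewrite adj_across.
- by rewrite adj_sym adj_across.
- by rewrite !glue_inr; have /forallP := vH y; apply.
Qed.

(** For a mixed pair both adjacencies are false: in [g] by closedness of [S], in [dunion a b] by
    definition. *)
Lemma glue_regmono : (glue \in RegMono g (dunion a b)) =
  (u \in RegMono (induced S) a) && (v \in RegMono (induced (~: S)) b).
Proof.
rewrite !inE glue_injective andbACA; congr andb.
apply/forallP/andP => [gH|[/forallP uH /forallP vH] x].
  split; apply/forallP => y; apply/forallP => y'.
    by have /forallP /(_ (val y')) := gH (val y); rewrite !glue_inl.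
  by have /forallP /(_ (val y')) := gH (val y); rewrite !glue_inr.
apply/forallP => x'.
case: (sideP S x) => y; case: (sideP S x') => y'.
- by rewrite !glue_inl; have /forallP := uH y; apply.
- by rewrite glue_inl glue_inr adj_across.
- by rewrite glue_inl glue_inr [X in _ == X]adj_sym adj_across.
- by rewrite !glue_inr; have /forallP := vH y; apply.
Qed.

Lemma glue_maps k : (glue \in maps k g (dunion a b)) =
  (u \in maps k (induced S) a) && (v \in maps k (induced (~: S)) b).
Proof.
case: k; [exact: glue_hom | | exact: glue_regmono].
by rewrite ![_ \in maps Defs.mono _ _]inE glue_hom glue_injective andbACA.
Qed.

Lemma glue_iso : (glue \in Iso g (dunion a b)) =
  (u \in Iso (induced S) a) && (v \in Iso (induced (~: S)) b).
Proof.
by rewrite ![_ \in Iso _ _]inE glue_regmono glue_surjective andbACA.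
Qed.

End Glue.

(** * Counting morphisms into a disjoint union *)

Lemma glueK (g a b : sgraph) (f : {ffun g -> dunion a b}) :
  exists u v, f = glue (S := left_part f) u v.
Proof.
(* The two components are the restrictions of [f] with the tags [inl] and [inr] removed. *)
have fl (y : induced (left_part f)) : {z | f (val y) = inl z}.
  by have := valP y; rewrite inE; case: (f (val y)) => // z; exists z.
have fr (y : induced (~: left_part f)) : {z | f (val y) = inr z}.
  by have := valP y; rewrite !inE; case: (f (val y)) => // z; exists z.
exists [ffun y => sval (fl y)], [ffun y => sval (fr y)]; apply/ffunP => x.
case: (sideP (left_part f) x) => y.
  by rewrite glue_inl ffunE; case: (fl y).
by rewrite glue_inr ffunE; case: (fr y).
Qed.

(* Stated for a class M of morphisms so as to apply to Iso as well as to maps. *)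
Lemma card_closed_split (M : forall g h : sgraph, {set {ffun g -> h}})
    (g a b : sgraph) :
  M g (dunion a b) \subset Defs.Hom g (dunion a b) ->
  (forall S : {set g}, closed_set S ->
     forall (u : {ffun induced S -> a}) (v : {ffun induced (~: S) -> b}),
     (glue u v \in M g (dunion a b)) =
     (u \in M (induced S) a) && (v \in M (induced (~: S)) b)) ->
  #|M g (dunion a b)| =
    (\sum_(S : {set g} | closed_set S)
       #|M (induced S) a| * #|M (induced (~: S)) b|)%N.
Proof.
move=> /subsetP MH MG; rewrite -sum1_card.
rewrite (partition_big (@left_part g a b) (@closed_set g)) => [|f /MH]; last first.
  exact: left_part_closed.
apply: eq_bigr => S clS; rewrite sum1_card -cardsX.
(* Gluing maps the pairs of components bijectively onto the morphisms with left part [S]. *)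
pose G (p : {ffun induced S -> a} * {ffun induced (~: S) -> b}) := glue p.1 p.2.
have Gi : injective G.
  move=> [u v] [u' v'] /ffunP E; congr pair; apply/ffunP => y.
    by have := E (val y); rewrite !glue_inl => -[].
  by have := E (val y); rewrite !glue_inr => -[].
rewrite -(card_imset _ Gi); apply: eq_card => f; apply/andP/imsetP => [[fM /eqP fS]|].
  have [u [v fE]] := glueK f; subst S; exists (u, v) => //.
  by rewrite in_setX -MG // -fE.
by case=> -[u v]; rewrite in_setX -MG // => ? ->; rewrite left_part_glue.
Qed.

Lemma regmono_sub_hom (g h : sgraph) : RegMono g h \subset Defs.Hom g h.
Proof.
apply/subsetP => f; rewrite !inE => /andP[_ /forallP fE].
apply/forallP => x; apply/forallP => y.
by have /forallP /(_ y) /eqP -> := fE x; apply: implybb.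
Qed.

Lemma maps_sub_hom k (g h : sgraph) : maps k g h \subset Defs.Hom g h.
Proof.
case: k => //=; last exact: regmono_sub_hom.
by apply/subsetP => f; rewrite inE => /andP[].
Qed.

Lemma card_maps_dunion k (g a b : sgraph) :
  #|maps k g (dunion a b)| =
    (\sum_(S : {set g} | closed_set S)
       #|maps k (induced S) a| * #|maps k (induced (~: S)) b|)%N.
Proof.
apply: (card_closed_split (M := maps k)); first exact: maps_sub_hom.
by move=> S clS u v; apply: glue_maps.
Qed.

Lemma card_Iso_dunion (g a b : sgraph) :
  #|Iso g (dunion a b)| =
    (\sum_(S : {set g} | closed_set S)
       #|Iso (induced S) a| * #|Iso (induced (~: S)) b|)%N.
Proof.
apply: (card_closed_split (M := Iso)).
  apply: subset_trans (regmono_sub_hom _ _).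
  by apply/subsetP => f; rewrite inE => /andP[].
by move=> S clS u v; apply: glue_iso.
Qed.

(** * Automorphisms and closed sets of a given type *)

(** Composition with isomorphisms injects [Iso g h] into [Iso h h] and back; without an isomorphism
    the set is empty. *)
Lemma card_Iso (g h : sgraph) : #|Iso g h| = (iso g h * #|Aut h|)%N.
Proof.
have [gh|] := boolP (iso g h); last by rewrite negbK => /eqP ->; rewrite cards0.
have le (u v u' v' : sgraph) : iso u u' -> iso v v' ->
    (#|Iso u v| <= #|Iso u' v'|)%N.
  move=> i j; have [F [Fi _ Fm]] := conj_mapsP i j.
  rewrite -(card_imset _ Fi); apply/subset_leq_card/subsetP.
  by move=> _ /imsetP[f /Fm + ->].
by rewrite mul1n; apply/eqP; rewrite eqn_leq !le ?iso_refl // iso_symi.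
Qed.

Lemma card_Aut_gt0 (g : sgraph) : (0 < #|Aut g|)%N.
Proof. by rewrite card_gt0; apply: iso_refl. Qed.

(* The closed sets of a given type form a single orbit of Aut g, with stabiliser
   Aut a x Aut b. *)
Lemma card_Aut_dunion (g a b : sgraph) : iso g (dunion a b) ->
  #|Aut g| = (#|[set S : {set g} | [&& closed_set S, iso (induced S) a
                                     & iso (induced (~: S)) b]]|
              * (#|Aut a| * #|Aut b|))%N.
Proof.
(* The isomorphisms from [g] to [dunion a b] are counted twice: there are [#|Aut g|] of them, and a
   closed set contributes [#|Aut a| * #|Aut b|] if it has type [(a, b)], else 0. *)
move=> gab; have := card_Iso_dunion g a b.
rewrite card_Iso gab mul1n -(card_Aut_iso gab) => ->.
rewrite -sum_nat_const big_mkcond [RHS]big_mkcond; apply: eq_bigr => S _.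
rewrite inE (card_Iso (induced S)) (card_Iso (induced (~: S))); case: (closed_set S) => //=.
by case: iso; case: iso; rewrite ?mul1n ?muln0.
Qed.

(** * Pairing functionals with the two coproducts *)

(** [Delta_hom'] is accessible only through its characterisation, as its existence proof is opaque;
    [closed_split_ext] satisfies the same characterisation, so uniqueness applies. *)
Lemma Delta_hom'_cls g : Delta_hom' << cls g >> = closed_split g.
Proof.
rewrite -closed_split_ext_cls; apply: (@Delta_hom'_unique Delta_hom' closed_split_ext).
  exact: Delta_hom'E.
elim/cls_ind=> h; rewrite connected_cls => hc.
apply: etrans (closed_split_ext_cls h) _.
apply: etrans (closed_split_connected hc) _.
by apply: (f_equal2 +%R); apply: esym; apply: tensU.
Qed.

Lemma tensfU (f1 f2 : {scalar QG}) (p : gclass * gclass) :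
  tensf f1 f2 << p >> = f1 << p.1 >> * f2 << p.2 >>.
Proof. by rewrite /tensf linextU. Qed.

Lemma tensf_closed_split (f1 f2 : {scalar QG}) g :
  tensf f1 f2 (closed_split g) =
    \sum_(S : {set g} | closed_set S)
       f1 << cls (induced S) >> * f2 << cls (induced (~: S)) >>.
Proof.
by rewrite linear_sum; apply: eq_bigr => S _; apply: tensfU.
Qed.

Lemma tensf_Delta_hom (f1 f2 : {scalar QG}) z :
  tensf f1 f2 (Delta_hom << z >>) =
    \sum_(p <- splittings z) f1 << p.1 >> * f2 << p.2 >>.
Proof.
rewrite /Delta_hom linextU linear_sum; apply: eq_bigr => p _.
exact: tensfE.
Qed.

Lemma sum_closed_splittings (g : sgraph) (F : gclass * gclass -> rat) :
  \sum_(S : {set g} | closed_set S) F (cls (induced S), cls (induced (~: S))) =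
  \sum_(p <- splittings (cls g))
     #|[set S : {set g} | [&& closed_set S, iso (induced S) (rep p.1)
                            & iso (induced (~: S)) (rep p.2)]]|%:R * F p.
Proof.
have pE (S : {set g}) p : ((cls (induced S), cls (induced (~: S))) == p) =
    iso (induced S) (rep p.1) && iso (induced (~: S)) (rep p.2).
  case: p => x y; rewrite xpair_eqE -[x in LHS]repK -[y in LHS]repK.
  by congr andb; apply/eqP/clsP.
(* A Kronecker delta over the types [p] allows the two sums to be exchanged. *)
transitivity (\sum_(p <- splittings (cls g)) \sum_(S : {set g} | closed_set S)
    if (cls (induced S), cls (induced (~: S))) == p then F p else 0).
  rewrite exchange_big /=; apply: eq_bigr => S clS.
  (* The type of [S] is a splitting and occurs only once in the duplicate-free enumeration, so one
     term survives. *)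
  rewrite -big_mkcond /= (big_rem (cls (induced S), cls (induced (~: S)))) /=.
    rewrite eqxx big_seq_cond big1 ?addr0 // => p /andP[+ /eqP pS].
    by rewrite -pS mem_rem_uniqF ?fset_uniq.
  rewrite in_splittings; apply/eqP; apply: etrans (clsM _ _) _.
  by apply/clsP/closed_set_split.
apply: eq_bigr => p _; rewrite -big_mkcondr /= sumr_const mulr_natl.
by congr (_ *+ _); apply: eq_card => S; rewrite inE -pE.
Qed.

(** * The two identities *)

Lemma Chen_GC k (g a b : sgraph) :
  GC k (cls (dunion a b)) << cls g >> =
  tensf (GC k (cls a)) (GC k (cls b)) (Delta_hom' << cls g >>).
Proof.
rewrite Delta_hom'_cls tensf_closed_split GC_cls card_maps_dunion natr_sum.
by apply: eq_bigr => S _; rewrite natrM; congr (_ * _); apply/esym/GC_cls.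
Qed.

Lemma card_maps_rep k (g a : sgraph) : #|maps k (rep (cls g)) a| = #|maps k g a|.
Proof. exact: (card_maps_iso k (rep_cls g) (iso_refl a)). Qed.

(** Dividing by [#|Aut g|] turns the number of closed sets of type [(x, y)] into the weight 1 /
    (|Aut x| |Aut y|) found on the right. *)
Lemma Chen_GC' k (g a b : sgraph) :
  GC' k (cls (dunion a b)) << cls g >> =
  tensf (GC' k (cls a)) (GC' k (cls b)) (Delta_hom << cls g >>).
Proof.
rewrite tensf_Delta_hom GC'_cls card_maps_dunion natr_sum.
(* The summand depends on [S] only through its type, so closed sets can be grouped. *)
pose F (p : gclass * gclass) : rat :=
  #|maps k (rep p.1) a|%:R * #|maps k (rep p.2) b|%:R.
rewrite (eq_bigr (fun S => F (cls (induced S), cls (induced (~: S))))); last first.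
  by move=> S _; rewrite natrM /F /= !card_maps_rep.
rewrite sum_closed_splittings mulr_suml; apply: eq_big_seq => -[x y].
rewrite in_splittings /F /= => /eqP xyg.
apply/esym; rewrite -{1}(repK x) -{1}(repK y).
apply: etrans (f_equal2 *%R (GC'_cls _ _ _) (GC'_cls _ _ _)) _; apply/esym.
have gxy : iso g (dunion (rep x) (rep y)).
  by apply/clsP; rewrite -xyg -clsM !repK.
have := card_Aut_gt0 g; rewrite (card_Aut_dunion gxy) muln_gt0 => /andP[+ _].
(* [N] divides the positive number [#|Aut g|], hence is nonzero and cancels. *)
set N := #|_| => N0; have Nn0 : N%:R != 0 :> rat by rewrite Num.Theory.pnatr_eq0 -lt0n.
rewrite !natrM mulf_div; apply: etrans (esym (mulf_div _ _ _ _)) _.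
by rewrite divff // mul1r.
Qed.

Theorem theorem3p19 (sigma Lambda Psi : gclass) :
  (forall k : kind,
     GC k (mmul Lambda Psi) << sigma >> =
     tensf (GC k Lambda) (GC k Psi) (Delta_hom' << sigma >>)) /\
  (forall k : kind,
     GC' k (mmul Lambda Psi) << sigma >> =
     tensf (GC' k Lambda) (GC' k Psi) (Delta_hom << sigma >>)).
Proof.
elim/cls_ind: sigma => g; elim/cls_ind: Lambda => a; elim/cls_ind: Psi => b.
have -> : mmul (cls a) (cls b) = cls (dunion a b) by exact: clsM.
by split=> k; [apply: Chen_GC | apply: Chen_GC'].
Qed.
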